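(* Let $\mathcal{H}$ be a Hilbert space and let $U(\mathcal{H})_u$ be its unitary group equipped with the uniform (operator norm) topology. Then the maximal $U(\mathcal{H})_u$-compactification of the unit sphere $\mathbb{S}_{\mathcal{H}}$ of $\mathcal{H}$ has no fixed points for the action of $U(\mathcal{H})$.
   Context: Hilbert spaces are complex; the sphere $\mathbb{S}_{\mathcal{H}}$ carries the norm topology and the natural action of $U(\mathcal{H})$. For a topological group $G$, a topological $G$-space is a topological space with a continuous action $G\times X\to X$; a morphism of $G$-spaces is a continuous $G$-equivariant map. The maximal $G$-compactification of a topological $G$-space $X$ is a compact Hausdorff $G$-space $\alpha_G(X)$ together with a morphism of $G$-spaces $i\colon X\to\alpha_G(X)$ with dense image such that any morphism from $X$ to a compact Hausdorff $G$-space factors through $i$. A fixed point is a point fixed by every element of the group. *)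

(* Defs.v *)
From HB Require Import structures.
From mathcomp Require Import all_boot all_order all_algebra.
From mathcomp Require Import sesquilinear.
From mathcomp Require Import all_classical all_reals all_analysis.
From mathcomp Require Import complex.

Set Implicit Arguments.
Unset Strict Implicit.
Unset Printing Implicit Defensive.

Import Order.TTheory GRing.Theory Num.Theory.
Import numFieldNormedType.Exports.

Local Open Scope classical_set_scope.
Local Open Scope ring_scope.

HB.mixin Record isTopologicalGroup G of Topological G & Group G := {
  mulg_continuous : continuous (fun p : G * G => (p.1 * p.2)%g) ;
  invg_continuous : continuous (fun g : G => g^-1%g)
}.

#[short(type="topologicalGroupType")]
HB.structure Definition TopologicalGroup :=
  {G of Topological G & Group G & isTopologicalGroup G}.

HB.mixin Record isGSpace (G : topologicalGroupType) X of Topological X := {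
  gact : G -> X -> X ;
  gact1 : forall x, gact 1%g x = x ;
  gactM : forall g h x, gact (g * h)%g x = gact g (gact h x) ;
  gact_continuous : continuous (fun p : G * X => gact p.1 p.2)
}.

#[short(type="gspaceType")]
HB.structure Definition GSpace (G : topologicalGroupType) :=
  {X of Topological X & isGSpace G X}.

Definition gspace_morphism (G : topologicalGroupType) (X Y : gspaceType G)
    (f : X -> Y) : Prop :=
  continuous f /\ forall (g : G) (x : X), f (gact g x) = gact g (f x).

Definition compact_hausdorff (X : topologicalType) : Prop :=
  compact [set: X] /\ hausdorff_space X.

Definition maximal_compactification (G : topologicalGroupType)
    (X A : gspaceType G) (i : X -> A) : Prop :=
  [/\ compact_hausdorff A, gspace_morphism i, dense (range i) &
      forall (Y : gspaceType G) (f : X -> Y),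
        compact_hausdorff Y -> gspace_morphism f ->
        exists2 phi : A -> Y, gspace_morphism phi & f = phi \o i].

Definition fixed_point (G : topologicalGroupType) (X : gspaceType G) (x : X) :
    Prop :=
  forall g : G, gact g x = x.

(* The inner product is linear in its first argument and conjugate-linear in
   the second one. *)
HB.mixin Record isHilbert (R : realType) H of CompleteNormedModule R[i] H := {
  inner : {dot H for @Num.conj R[i]} ;
  sqr_norm_inner : forall x : H, `|x| ^+ 2 = inner x x
}.

#[short(type="hilbertType")]
HB.structure Definition Hilbert (R : realType) :=
  {H of CompleteNormedModule R[i] H & isHilbert R H}.

Section RealNorm.
Context {R : realType} {H : hilbertType R}.
Implicit Types x y : H.

(* The norm of [H] takes its values in [R[i]], but is real. *)
Definition rnorm x : R := complex.Re `|x|.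

Lemma rnormE x : `|x| = (rnorm x)%:C%C.
Proof. by apply/eqP; rewrite eq_complex /= eqxx ger0_Im //= normr_ge0. Qed.

Lemma rnorm_ge0 x : 0 <= rnorm x.
Proof. by rewrite -ler0c -rnormE normr_ge0. Qed.

Lemma rnormD x y : rnorm (x + y) <= rnorm x + rnorm y.
Proof.
have := ler_normD x y; rewrite !rnormE.
by rewrite -[(rnorm x)%:C%C + _]raddfD lecR.
Qed.

Lemma rnormN x : rnorm (- x) = rnorm x.
Proof. by rewrite /rnorm normrN. Qed.

Lemma rnorm0_eq0 x : rnorm x = 0 -> x = 0.
Proof. by move=> x0; apply/normr0_eq0; rewrite rnormE x0. Qed.

Lemma rnormZ (a : R) x : 0 <= a -> rnorm (a%:C%C *: x) = a * rnorm x.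
Proof.
move=> a0; rewrite /rnorm normrZ rnormE ger0_norm ?ler0c//.
by rewrite -[_%:C%C * _]rmorphM.
Qed.

Lemma rnorm_le1 x : (`|x| <= 1) = (rnorm x <= 1).
Proof. by rewrite rnormE -lecR. Qed.

End RealNorm.

Definition opnorm (R : realType) (H : hilbertType R) (f : H -> H) : R :=
  sup [set rnorm (f x) | x in [set x : H | `|x| <= 1]].

Section Unitary.
Context {R : realType} (H : hilbertType R).

Record unitary := Unitary {
  unitary_fun :> H -> H ;
  unitary_linear : linear unitary_fun ;
  unitary_inner : forall x y : H,
    inner (unitary_fun x) (unitary_fun y) = inner x y ;
  unitary_surj : forall y : H, exists x : H, unitary_fun x = y
}.

End Unitary.

Section UnitaryGroup.
Context {R : realType} {H : hilbertType R}.
Implicit Types u v w : unitary H.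

Lemma unitary_ext u v : (forall x, u x = v x) -> u = v.
Proof.
case: u v => [f fl fi fs] [g gl gi gs] /= /funext fg; case: _ / fg gl gi gs.
by move=> gl gi gs; congr Unitary; exact: Prop_irrelevance.
Qed.

Lemma unitary_norm u x : `|u x| = `|x|.
Proof.
apply/eqP; rewrite -(@eqrXn2 _ 2 `|u x| `|x|) ?normr_ge0//.
by rewrite !sqr_norm_inner unitary_inner.
Qed.

Lemma unitary_rnorm u x : rnorm (u x) = rnorm x.
Proof. by rewrite /rnorm unitary_norm. Qed.

Lemma unitaryB u x y : u (x - y) = u x - u y.
Proof. by rewrite -scaleN1r addrC unitary_linear scaleN1r addrC. Qed.

Lemma unitaryZ u (a : R[i]) x : u (a *: x) = a *: u x.
Proof.
have u0 : u 0 = 0 by have := unitaryB u 0 0; rewrite !subrr.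
by rewrite -[a *: x]addr0 unitary_linear u0 addr0.
Qed.

Lemma unitary_inj u : injective u.
Proof.
move=> x y uxy; apply/eqP; rewrite -subr_eq0 -normr_eq0 -(unitary_norm u).
by rewrite unitaryB uxy subrr normr0.
Qed.

Definition unitary_one : unitary H :=
  Unitary (fun a x y => erefl) (fun x y => erefl) (fun y => ex_intro _ y erefl).

Fact unitary_mul_linear u v : linear (u \o v).
Proof. by move=> a x y /=; rewrite !unitary_linear. Qed.

Fact unitary_mul_inner u v x y : inner ((u \o v) x) ((u \o v) y) = inner x y.
Proof. by rewrite /= !unitary_inner. Qed.

Fact unitary_mul_surj u v y : exists x, (u \o v) x = y.
Proof.
have [z <-] := unitary_surj u y; have [x <-] := unitary_surj v z.
by exists x.
Qed.

Definition unitary_mul u v : unitary H :=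
  Unitary (unitary_mul_linear u v) (unitary_mul_inner u v)
          (unitary_mul_surj u v).

Definition unitary_inv_fun u (y : H) : H := projT1 (cid (unitary_surj u y)).

Lemma unitary_invK u y : u (unitary_inv_fun u y) = y.
Proof. exact: projT2 (cid (unitary_surj u y)). Qed.

Fact unitary_inv_linear u : linear (unitary_inv_fun u).
Proof.
move=> a x y /=; apply: (@unitary_inj u).
by rewrite unitary_linear !unitary_invK.
Qed.

Fact unitary_inv_inner u x y :
  inner (unitary_inv_fun u x) (unitary_inv_fun u y) = inner x y.
Proof. by rewrite -(unitary_inner u) !unitary_invK. Qed.

Fact unitary_inv_surj u y : exists x, unitary_inv_fun u x = y.
Proof.
by exists (u y); apply: (@unitary_inj u); rewrite unitary_invK.
Qed.

Definition unitary_inv u : unitary H :=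
  Unitary (unitary_inv_linear u) (unitary_inv_inner u) (unitary_inv_surj u).

HB.instance Definition _ := gen_eqMixin (unitary H).
HB.instance Definition _ := gen_choiceMixin (unitary H).

Fact unitary_mulA : associative unitary_mul.
Proof. by move=> u v w; exact: unitary_ext. Qed.
Fact unitary_1mul : left_id unitary_one unitary_mul.
Proof. by move=> u; exact: unitary_ext. Qed.
Fact unitary_mul1 : right_id unitary_one unitary_mul.
Proof. by move=> u; exact: unitary_ext. Qed.
Fact unitary_Vmul : left_inverse unitary_one unitary_inv unitary_mul.
Proof.
move=> u; apply: unitary_ext => x /=.
by apply: (@unitary_inj u); rewrite unitary_invK.
Qed.
Fact unitary_mulV : right_inverse unitary_one unitary_inv unitary_mul.
Proof. by move=> u; apply: unitary_ext => x /=; rewrite unitary_invK. Qed.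

HB.instance Definition _ := isGroup.Build (unitary H)
  unitary_mulA unitary_1mul unitary_mul1 unitary_Vmul unitary_mulV.

Definition unitary_dist u v : R := opnorm (fun x => u x - v x).

Lemma unitary_dist_ub u v x : rnorm x <= 1 ->
  rnorm (u x - v x) <= unitary_dist u v.
Proof.
move=> x1; apply: ub_le_sup; last by exists x; rewrite //= rnorm_le1.
exists 2 => _ [y /= + <-]; rewrite rnorm_le1 => y1.
rewrite (le_trans (rnormD _ _))// rnormN !unitary_rnorm.
by rewrite -[2]/(1 + 1)%R lerD.
Qed.

Lemma unitary_dist_le u v (e : R) :
  (forall x, rnorm x <= 1 -> rnorm (u x - v x) <= e) -> unitary_dist u v <= e.
Proof.
move=> uve; apply: ge_sup.
  by exists (rnorm (u 0 - v 0)); exists 0 => //=; rewrite normr0.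
by move=> _ [x /= + <-]; rewrite rnorm_le1 => /uve.
Qed.

Fact unitary_dist_xx u : unitary_dist u u = 0.
Proof.
have rn0 : rnorm (0 : H) = 0 by rewrite /rnorm normr0.
apply/eqP; rewrite eq_le; apply/andP; split.
  by apply: unitary_dist_le => x _; rewrite subrr rn0.
by rewrite -[leLHS](rn0) -(subrr (u 0)) unitary_dist_ub// rn0.
Qed.

Fact unitary_dist_eq0 u v : unitary_dist u v = 0 -> u = v.
Proof.
move=> uv0; apply: unitary_ext => x.
have uv1 y : rnorm y <= 1 -> u y = v y.
  move=> y1; apply/eqP; rewrite -subr_eq0; apply/eqP; apply: rnorm0_eq0.
  by apply/eqP; rewrite eq_le rnorm_ge0 andbT -uv0 unitary_dist_ub.
have [x1|x1] := leP (rnorm x) 1; first exact: uv1.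
have x0 : 0 < rnorm x by rewrite (lt_trans ltr01).
have /uv1 : rnorm ((rnorm x)^-1%:C%C *: x) <= 1.
  by rewrite rnormZ ?invr_ge0 ?rnorm_ge0// mulVf ?gt_eqF.
rewrite !unitaryZ => /scalerI; apply.
by apply/eqP => /(congr1 (@complex.Re R))/= /eqP; rewrite invr_eq0 gt_eqF.
Qed.

Fact unitary_dist_sym u v : unitary_dist u v = unitary_dist v u.
Proof.
by rewrite /unitary_dist /opnorm; congr (sup (_ @` _)); apply/funext => x /=;
  rewrite -rnormN opprB.
Qed.

Fact unitary_dist_triangle v u w :
  unitary_dist u w <= unitary_dist u v + unitary_dist v w.
Proof.
apply: unitary_dist_le => x x1.
rewrite -(subrK (v x) (u x)) -addrA (le_trans (rnormD _ _))//.
by rewrite lerD ?unitary_dist_ub.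
Qed.

HB.instance Definition _ := @isMetric.Build R (unitary H) unitary_dist
  unitary_dist_xx unitary_dist_eq0 unitary_dist_sym unitary_dist_triangle.

Lemma unitary_ball u (e : R) v : ball u e v = (unitary_dist u v < e) :> Prop.
Proof. by rewrite ballEmdist. Qed.

Lemma unitary_nbhs u (P : set (unitary H)) :
  nbhs u P <-> exists2 e : R, 0 < e & forall v, unitary_dist u v < e -> P v.
Proof.
split=> [/(@nbhs_ballP R)[e /= e0 eP]|[e e0 eP]].
  by exists e => // v uv; apply: eP; rewrite unitary_ball.
by apply/(@nbhs_ballP R); exists e => //= v; rewrite unitary_ball => /eP.
Qed.

Fact unitary_mul_continuous :
  continuous (fun p : unitary H * unitary H => (p.1 * p.2)%g).
Proof.
move=> [u v] P /= /unitary_nbhs [e e0 eP].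
exists (ball u (e / 2), ball v (e / 2)).
  by split; apply: nbhsx_ballx; rewrite divr_gt0.
move=> [u' v'] /= []; rewrite !unitary_ball => uu' vv'; apply: eP.
rewrite (splitr e) (le_lt_trans _ (ltrD uu' vv'))//.
apply: unitary_dist_le => x x1 /=.
have -> : u (v x) - u' (v' x) = (u (v' x) - u' (v' x)) + u (v x - v' x).
  by rewrite unitaryB [RHS]addrC addrA subrK.
rewrite (le_trans (rnormD _ _))// lerD//.
  by rewrite unitary_dist_ub// unitary_rnorm.
by rewrite unitary_rnorm unitary_dist_ub.
Qed.

Fact unitary_inv_continuous : continuous (fun u : unitary H => u^-1%g).
Proof.
move=> u P /= /unitary_nbhs [e e0 eP]; apply/unitary_nbhs; exists e => // v uv.
apply: eP; rewrite (le_lt_trans _ uv)//; apply: unitary_dist_le => x x1 /=.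
rewrite -(unitary_rnorm v) unitaryB unitary_invK.
rewrite -[in X in _ - X](unitary_invK u x) -rnormN opprB.
by rewrite unitary_dist_ub// -(unitary_rnorm u) unitary_invK.
Qed.

HB.instance Definition _ := isTopologicalGroup.Build (unitary H)
  unitary_mul_continuous unitary_inv_continuous.

End UnitaryGroup.

Definition sphere (R : realType) (H : hilbertType R) : Type :=
  set_type [set x : H | `|x| = 1].

HB.instance Definition _ (R : realType) (H : hilbertType R) :=
  Topological.copy (sphere H) (set_type [set x : H | `|x| = 1]).

Section Sphere.
Context {R : realType} {H : hilbertType R}.

Definition sphere_val (x : sphere H) : H := set_val x.

Lemma sphere_norm (x : sphere H) : `|sphere_val x| = 1.
Proof. exact: (set_valP x). Qed.

Fact sphere_act_subproof (u : unitary H) (x : sphere H) :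
  u (sphere_val x) \in [set x : H | `|x| = 1].
Proof. by rewrite inE /= unitary_norm sphere_norm. Qed.

Definition sphere_act (u : unitary H) (x : sphere H) : sphere H :=
  exist _ (u (sphere_val x)) (sphere_act_subproof u x).

Lemma sphere_actE u x : sphere_val (sphere_act u x) = u (sphere_val x).
Proof. by rewrite /sphere_val set_valE. Qed.

Lemma sphere_val_inj : injective sphere_val.
Proof. by move=> x y; rewrite /sphere_val set_valE => /val_inj. Qed.

Fact sphere_act1 x : sphere_act 1%g x = x.
Proof. by apply: sphere_val_inj; rewrite sphere_actE. Qed.

Fact sphere_actM u v x :
  sphere_act (u * v)%g x = sphere_act u (sphere_act v x).
Proof. by apply: sphere_val_inj; rewrite !sphere_actE. Qed.

Fact sphere_act_continuous :
  continuous (fun p : unitary H * sphere H => sphere_act p.1 p.2).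
Proof.
apply: continuous_comp_initial => -[u x].
apply/(@cvgrPdist_lt _ H) => e e0 /=.
have {e0} [r r0 ->] : exists2 r : R, 0 < r & e = r%:C%C.
  exists (complex.Re e); move: e0; rewrite ltcE /= => /andP[/eqP ie re] //.
  by apply/eqP; rewrite eq_complex /= ie !eqxx.
have r20 : 0 < r / 2 by rewrite divr_gt0.
exists (ball u (r / 2), [set y | rnorm (sphere_val x - sphere_val y) < r / 2]).
  split; first exact: nbhsx_ballx.
  have := @initial_continuous (sphere H) H sphere_val x.
  move=> /(@cvgrPdist_lt _ H)/(_ (r / 2)%:C%C); rewrite ltcR => /(_ r20).
  by apply: filterS => y; rewrite rnormE ltcR.
move=> [v y] /= []; rewrite unitary_ball => uv xy.
rewrite rnormE ltcR -!/(sphere_val _) !sphere_actE.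
rewrite -(subrK (u (sphere_val y)) (u _)) -addrA.
rewrite (le_lt_trans (rnormD _ _))// (splitr r) ltrD//.
  by rewrite -unitaryB unitary_rnorm.
by rewrite (le_lt_trans _ uv)// unitary_dist_ub// -rnorm_le1 sphere_norm.
Qed.

HB.instance Definition _ := isGSpace.Build (unitary H) (sphere H)
  sphere_act1 sphere_actM sphere_act_continuous.

End Sphere.

(* Main.v *)
(* A 1-Lipschitz function f on H vanishing at 0 extends continuously to the
   maximal compactification: x |-> (u |-> f (u x)) is a morphism from the sphere
   to a compact G-space of Lipschitz functions on G = U(H), pointwise topology.
   The traces on the sphere of the neighbourhoods of a fixed point therefore
   form a proper filter along which f (u x) - f x tends to 0 for every u.

   Along this filter <x, b> tends to 0 for each unit vector b (take u b = - b).
   By Zorn's lemma there are an orthonormal family e_(i, n), n in nat, and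
   finitely many orthonormal vectors b that together span a dense subspace of H;
   so |P x| tends to 1, where P projects onto the closed span of the e_(i, n).
   If P_k,m denotes the projection onto the closed span of the e_(i, n) with
   n = m mod k, a unitary swapping two disjoint classes shows that |P_2,0 x|,
   |P_2,1 x|, |P_4,1 x| and |P_4,3 x| are asymptotically equal.  Since
   |P_2,1 x|^2 = |P_4,1 x|^2 + |P_4,3 x|^2, all of them tend to 0, and so does
   |P x|^2 = |P_2,0 x|^2 + |P_2,1 x|^2, a contradiction. *)
Require Import Defs.
From HB Require Import structures.
From mathcomp Require Import all_boot all_order all_algebra.
From mathcomp Require Import sesquilinear zify ring lra.
From mathcomp Require Import all_classical all_reals all_analysis.
From mathcomp Require Import complex.

Set Implicit Arguments.
Unset Strict Implicit.
Unset Printing Implicit Defensive.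

Import Order.TTheory GRing.Theory Num.Theory.
Import numFieldNormedType.Exports.

Local Open Scope classical_set_scope.
Local Open Scope ring_scope.

(** * Inner products *)

Section Inner.
Context {R : realType} {H : hilbertType R}.
Implicit Types x y z : H.

Lemma innerC x y : inner x y = Num.conj (inner y x).
Proof. by rewrite hermC expr0 mul1r. Qed.

Lemma innerZl (a : R[i]) x y : inner (a *: x) y = a * inner x y.
Proof. exact: linearZl_LR. Qed.

Lemma innerZr (a : R[i]) x y : inner x (a *: y) = Num.conj a * inner x y.
Proof. exact: linearZr_LR. Qed.

Lemma innerDl x y z : inner (x + y) z = inner x z + inner y z.
Proof. exact: linearDl. Qed.

Lemma innerDr x y z : inner z (x + y) = inner z x + inner z y.
Proof. exact: linearDr. Qed.

Lemma innerNl x y : inner (- x) y = - inner x y.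
Proof. exact: linearNl. Qed.

Lemma innerNr x y : inner x (- y) = - inner x y.
Proof. exact: linearNr. Qed.

Lemma inner_eq0C x y : inner x y = 0 -> inner y x = 0.
Proof. by rewrite innerC => xy0; rewrite -[inner y x]conjCK xy0 rmorph0. Qed.

Lemma inner_rnorm x : inner x x = (rnorm x ^+ 2)%:C%C.
Proof. by rewrite -sqr_norm_inner rnormE rmorphXn. Qed.

Lemma inner_self_eq0 x : inner x x = 0 -> x = 0.
Proof.
by rewrite -sqr_norm_inner => /eqP; rewrite sqrf_eq0 normr_eq0 => /eqP.
Qed.

Lemma rnorm_sqrD x y :
  inner x y = 0 -> rnorm (x + y) ^+ 2 = rnorm x ^+ 2 + rnorm y ^+ 2.
Proof.
move=> xy0; apply: (@complexI R); rewrite [RHS]rmorphD /= -!inner_rnorm.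
exact: hnormDd.
Qed.

Lemma parallelogram x y :
  rnorm (x + y) ^+ 2 + rnorm (x - y) ^+ 2 = 2 * (rnorm x ^+ 2 + rnorm y ^+ 2).
Proof.
apply: (@complexI R); rewrite [2 * _]mulrDl mul1r ![X in X = _]rmorphD.
rewrite [X in _ = X]rmorphD !(rmorphD _ (rnorm x ^+ 2)) /= -!inner_rnorm.
rewrite !(innerDl, innerDr, innerNl, innerNr).
ring.
Qed.

(** Pythagoras for the component of [x] along [y] and the remainder. The bound makes real parts of
    inner products admissible as 1-Lipschitz test functions. *)
Lemma Re_inner_le x y : rnorm y = 1 -> `|complex.Re (inner x y)| <= rnorm x.
Proof.
move=> y1; have yy1 : inner y y = 1 by rewrite inner_rnorm y1 expr1n.
set a := inner x y.
have xy0 : inner (x - a *: y) (a *: y) = 0.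
  by rewrite innerZr innerDl innerNl innerZl yy1 mulr1 subrr mulr0.
have := rnorm_sqrD xy0; rewrite subrK => xE.
have aE : rnorm (a *: y) ^+ 2 = complex.Re a ^+ 2 + complex.Im a ^+ 2.
  apply: (@complexI R); rewrite -inner_rnorm innerZl innerZr yy1 mulr1.
  case: (a) => u v /=; apply/eqP; rewrite eq_complex /=; apply/andP.
  by split; apply/eqP; ring.
rewrite -ler_sqr ?nnegrE ?rnorm_ge0// real_normK ?num_real// xE aE.
by rewrite addrCA lerDl addr_ge0 ?sqr_ge0.
Qed.

Lemma rnorm_iZ x : rnorm ('i%C *: x) = rnorm x.
Proof.
rewrite /rnorm normrZ normc_def /= expr0n expr1n add0r sqrtr1.
by rewrite rmorph1 mul1r.
Qed.

Lemma rnormZ_le (a : R[i]) x :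
  rnorm x = 1 -> rnorm (a *: x) <= `|complex.Re a| + `|complex.Im a|.
Proof.
move=> x1; have -> : a *: x =
    (complex.Re a)%:C%C *: x + (complex.Im a)%:C%C *: ('i%C *: x).
  by rewrite scalerA -scalerDl mulrC -complexE.
have rnZ (b : R) y : rnorm (b%:C%C *: y) = `|b| * rnorm y.
  have [b0|b0] := ger0P b; first by rewrite rnormZ.
  by rewrite -rnormN -scaleNr -raddfN rnormZ // oppr_ge0 ltW.
by apply: (le_trans (rnormD _ _)); rewrite !rnZ rnorm_iZ x1 !mulr1.
Qed.

End Inner.

(** * Orthogonal projections *)

Section Projection.
Context {R : realType} {H : hilbertType R}.
Implicit Types (x y z : H) (S K : set H).

Lemma rnorm_nbhs x (e : R) : 0 < e -> \forall y \near x, rnorm (x - y) < e.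
Proof.
move=> e0; have e0C : (0 : R[i]) < e%:C%C by rewrite ltcR.
apply: filterS (nbhsx_ballx x _ e0C) => y.
by rewrite -ball_normE /ball_ /= rnormE ltcR.
Qed.

Lemma rnorm_cauchy_cvg (F : set_system H) : ProperFilter F ->
  (forall e : R, 0 < e -> exists x, F [set y | rnorm (x - y) < e]) -> cvg F.
Proof.
move=> PF Fc; apply: cauchy_cvg; apply: cauchy_exP => e /= e0.
(* In the order of [R[i]] a positive element has zero imaginary part, so real radii suffice. *)
have {e0} [r r0 ->] : exists2 r : R, 0 < r & e = r%:C%C.
  exists (complex.Re e); move: e0; rewrite ltcE /= => /andP[/eqP ie re] //.
  by apply/eqP; rewrite eq_complex /= ie !eqxx.
have [x Fx] := Fc r r0; exists x; apply: filterS Fx => y /= xy.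
by rewrite -ball_normE /ball_ /= rnormE ltcR.
Qed.

(** By the parallelogram law the near-minimisers of the distance form a Cauchy filter; only
    midpoints enter, hence this form of convexity. *)
Lemma ex_closest K x : closed K -> K !=set0 ->
  (forall y z, K y -> K z -> K (2^-1 *: (y + z))) ->
  exists2 y, K y & forall z, K z -> rnorm (x - y) <= rnorm (x - z).
Proof.
move=> cK [k0 Kk0] mK.
pose D := [set rnorm (x - z) | z in K]; pose d := inf D.
have D0 : D !=set0 by exists (rnorm (x - k0)), k0.
have lD : has_lbound D by exists 0 => _ [z _ <-]; exact: rnorm_ge0.
have dle z : K z -> d <= rnorm (x - z).
  by move=> Kz; apply: ge_inf => //; exists z.
have d0 : 0 <= d by apply: lb_le_inf => // _ [z _ <-]; exact: rnorm_ge0.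
pose B (e : R) := K `&` [set z | rnorm (x - z) < d + e].
have B0 e : 0 < e -> B e !=set0.
  move=> e0; have [|_ [z Kz <-] ze] := @inf_adherent _ D e e0; first by split.
  by exists z.
pose F := filter_from [set e : R | 0 < e] B.
have FF : ProperFilter F.
  apply: filter_from_proper => //; apply: filter_from_filter.
    by exists 1 => /=.
  move=> e f /= e0 f0; exists (Num.min e f); first by rewrite /= lt_min e0 f0.
  move=> z [Kz /= ze].
  by split; split=> //=; apply: (lt_le_trans ze);
    rewrite lerD2l ge_min lexx ?orbT.
have cF : cvg F.
  apply: rnorm_cauchy_cvg => e e0.
  (* Two points of [K] at distance less than [d + f] from [x] have squared mutual distance below
     [4 * (d + f) ^+ 2 - 4 * d ^+ 2], since their midpoint is at distance at least [d]. For [f <= 1]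
     this is at most [(8 * d + 4) * f], hence at most [e ^+ 2]. *)
  pose f := Num.min 1 (e ^+ 2 / (4 * (2 * d + 2))).
  have c0 : 0 < 4 * (2 * d + 2) by lra.
  have f0 : 0 < f by rewrite lt_min ltr01 divr_gt0 ?exprn_gt0.
  have f1 : f <= 1 by rewrite ge_min lexx.
  have fe : f * (4 * (2 * d + 2)) <= e ^+ 2.
    by rewrite -ler_pdivlMr // ge_min lexx orbT.
  have [y [Ky /= yf]] := B0 f f0; exists y; exists f => // z [Kz /= zf].
  have := parallelogram (x - y) (x - z).
  have -> : x - y - (x - z) = - (y - z) by rewrite !opprB addrC addrA subrK.
  have -> : x - y + (x - z) = 2%:R%:C%C *: (x - 2^-1 *: (y + z)).
    rewrite scalerBr scalerA rmorphMn rmorph1 mulfV ?pnatr_eq0 // scale1r.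
    by rewrite scaler_nat mulr2n addrACA opprD.
  rewrite rnormZ ?ler0n // rnormN => par.
  have dm := dle _ (mK _ _ Ky Kz).
  have := rnorm_ge0 (x - y); have := rnorm_ge0 (x - z) => z0 y0.
  rewrite -ltr_sqr ?nnegrE ?rnorm_ge0 ?ltW //.
  move: par dm yf zf z0 y0 fe.
  move: (rnorm (x - y)) (rnorm (x - z)) (rnorm (y - z)) (rnorm (x - _)).
  move=> a b c m par dm af bf b0 a0 fe.
  have m2 : d ^+ 2 <= m ^+ 2 by rewrite ler_sqr ?nnegrE // (le_trans d0).
  have a2 : a ^+ 2 < (d + f) ^+ 2 by rewrite ltr_sqr ?nnegrE // addr_ge0 // ltW.
  have b2 : b ^+ 2 < (d + f) ^+ 2 by rewrite ltr_sqr ?nnegrE // addr_ge0 // ltW.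
  have ff : f ^+ 2 <= f by rewrite expr2 ler_piMl // ltW.
  nra.
have Klim : K (lim F).
  have FK : F K by exists 1 => //= z [].
  exact: (@closed_cvg _ _ F FF id K cK FK _ cF).
exists (lim F) => // z Kz; apply: (le_trans _ (dle z Kz)).
apply/ler_addgt0Pl => e e0.
have e20 : 0 < e / 2 by rewrite divr_gt0.
have Fnear : F [set y | rnorm (lim F - y) < e / 2].
  exact: (cF _ (rnorm_nbhs _ e20)).
have FB : F (B (e / 2)) by exists (e / 2).
have [y [/= y1 [Ky /= y2]]] := filter_ex (filterI Fnear FB).
have y3 : rnorm (y - lim F) < e / 2 by rewrite -rnormN opprB.
have := rnormD (x - y) (y - lim F); rewrite addrA subrK.
move: y2 y3; lra.
Qed.

Definition perp S : set H := [set x | forall s, S s -> inner x s = 0].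

Lemma perp0 S : perp S 0.
Proof. by move=> s _; exact: linear0l. Qed.

Lemma perpD S x y : perp S x -> perp S y -> perp S (x + y).
Proof. by move=> Sx Sy s Ss; rewrite innerDl Sx // Sy // addr0. Qed.

Lemma perpN S x : perp S x -> perp S (- x).
Proof. by move=> Sx s Ss; rewrite innerNl Sx // oppr0. Qed.

Lemma perpZ S a x : perp S x -> perp S (a *: x).
Proof. by move=> Sx s Ss; rewrite innerZl Sx // mulr0. Qed.

Lemma sub_perp S K : S `<=` K -> perp K `<=` perp S.
Proof. by move=> SK x Kx s /SK; exact: Kx. Qed.

Lemma sub_perp2 S : S `<=` perp (perp S).
Proof. by move=> x Sx y Sy; apply: inner_eq0C; exact: Sy. Qed.

Lemma perp_closed S : closed (perp S).
Proof.
move=> x clx s Ss.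
have [->|s0] := eqVneq s 0; first exact: linear0r.
pose t := (rnorm s)^-1%:C%C *: s.
have s1 : 0 < rnorm s.
  by rewrite lt_def rnorm_ge0 andbT; apply: contra_neq s0 => /rnorm0_eq0.
have t1 : rnorm t = 1 by rewrite rnormZ ?invr_ge0 ?rnorm_ge0 // mulVf ?gt_eqF.
have St z : perp S z -> inner z t = 0.
  by move=> Sz; rewrite innerZr Sz // mulr0.
have Re_eq0 v : rnorm v = 1 -> (forall z, perp S z -> inner z v = 0) ->
    complex.Re (inner x v) = 0.
  move=> v1 Sv; apply/eqP; rewrite -normr_le0; apply/ler_addgt0Pl => e e0.
  have [y [Sy /= xy]] := clx _ (rnorm_nbhs x e0).
  have -> : inner x v = inner (x - y) v.
    by rewrite innerDl innerNl (Sv y) // subr0.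
  by rewrite addr0 (le_trans (Re_inner_le _ v1)) // ltW.
have Re0 := Re_eq0 _ t1 St.
(* The real part of the inner product with ['i%C *: t] is the imaginary part of the inner product
   with [t]. *)
have it1 : rnorm ('i%C *: t) = 1.
  by rewrite rnorm_iZ.
have Im0 : complex.Im (inner x t) = 0.
  have := Re_eq0 _ it1; rewrite innerZr => <-.
    by case: (inner x t) => a b /=; ring.
  by move=> z Sz; rewrite innerZr St // mulr0.
have : inner x t = 0 by apply/eqP; rewrite eq_complex Re0 Im0 /= !eqxx.
rewrite innerZr => /eqP; rewrite mulf_eq0 conjC_eq0 => /orP[|/eqP //].
by move=> /eqP/(congr1 (@complex.Re R))/= /eqP; rewrite invr_eq0 gt_eqF.
Qed.

(** If [z] is the point of [perp S] closest to [x], then [x - z] is orthogonal to [perp S], so it is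
    the component sought. *)
Lemma orthproj_ex S x : exists y, perp (perp S) y /\ perp S (x - y).
Proof.
have [|y z Sy Sz|z Sz zmin] := @ex_closest (perp S) x (@perp_closed S).
- by exists 0; exact: perp0.
- by apply: perpZ; exact: perpD.
exists (x - z); split=> [h Sh|]; last by rewrite opprB addrC subrK.
have [->|h0] := eqVneq h 0; first exact: linear0r.
(* Moving [z] by [a *: h] inside [perp S] lowers the squared distance to [x] by
   [rnorm (a *: h) ^+ 2]; minimality forces [a *: h = 0]. *)
pose a := inner (x - z) h / inner h h.
have hh0 : inner h h != 0 by apply: contra_neq h0 => /inner_self_eq0.
have o : inner (x - z - a *: h) h = 0.
  by rewrite (innerDl (x - z)) innerNl innerZl divfK // subrr.
have := @rnorm_sqrD _ _ (x - z - a *: h) (a *: h).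
rewrite innerZr o mulr0 subrK => /(_ erefl) E.
have Sza : perp S (z + a *: h) by apply: perpD => //; exact: perpZ.
have := zmin _ Sza; rewrite opprD addrA -ler_sqr ?nnegrE ?rnorm_ge0 // E.
rewrite gerDl => le0; have : a *: h = 0.
  apply: rnorm0_eq0; apply/eqP; rewrite -sqrf_eq0 eq_le le0.
  exact: sqr_ge0.
by move=> ah0; move: o; rewrite ah0 oppr0 addr0.
Qed.

End Projection.

(** * Calculus of projections, reflections and swapping unitaries *)

Section ProjectionTheory.
Context {R : realType} {H : hilbertType R}.
Implicit Types (x y z : H) (S K : set H).

(** The range is [perp (perp S)], the closed linear span of [S], so [S] may be any set of
    vectors. *)
Definition orthproj S x : H := projT1 (cid (orthproj_ex S x)).

Lemma orthproj_perp2 S x : perp (perp S) (orthproj S x).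
Proof. by have [] := projT2 (cid (orthproj_ex S x)). Qed.

Arguments orthproj_perp2 : clear implicits.

Lemma subr_orthproj S x : perp S (x - orthproj S x).
Proof. by have [] := projT2 (cid (orthproj_ex S x)). Qed.

Arguments subr_orthproj : clear implicits.

Lemma perp_perp2_eq0 S x : perp S x -> perp (perp S) x -> x = 0.
Proof. by move=> Sx SSx; apply: inner_self_eq0; exact: SSx. Qed.

Lemma orthproj_unique S x y :
  perp (perp S) y -> perp S (x - y) -> orthproj S x = y.
Proof.
move=> SSy Sxy; apply/eqP; rewrite -subr_eq0; apply/eqP.
apply: (@perp_perp2_eq0 S); last exact: perpD (orthproj_perp2 S x) (perpN SSy).
have -> : orthproj S x - y = (x - y) - (x - orthproj S x).
  by rewrite opprB addrCA addrAC subrr add0r.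
exact: perpD Sxy (perpN (subr_orthproj _ _)).
Qed.

Lemma orthproj_linear S : linear (orthproj S).
Proof.
move=> a x y /=; apply: orthproj_unique.
  by apply: perpD (orthproj_perp2 _ _); exact: perpZ (orthproj_perp2 _ _).
rewrite opprD addrACA -scalerBr.
by apply: perpD (subr_orthproj _ _); exact: perpZ (subr_orthproj _ _).
Qed.

Lemma orthprojB S x y : orthproj S (x - y) = orthproj S x - orthproj S y.
Proof. by rewrite -scaleN1r addrC orthproj_linear scaleN1r addrC. Qed.

Lemma rnorm_sqr_orthproj S x :
  rnorm x ^+ 2 = rnorm (orthproj S x) ^+ 2 + rnorm (x - orthproj S x) ^+ 2.
Proof.
rewrite -rnorm_sqrD; first by rewrite addrC subrK.
by apply: (orthproj_perp2 S x); exact: subr_orthproj.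
Qed.

Lemma rnorm_orthproj S x : rnorm (orthproj S x) <= rnorm x.
Proof.
rewrite -ler_sqr ?nnegrE ?rnorm_ge0 // (rnorm_sqr_orthproj S x) lerDl.
exact: sqr_ge0.
Qed.

Lemma rnormB_le x y : `|rnorm x - rnorm y| <= rnorm (x - y).
Proof.
have := rnormD y (x - y); rewrite addrC subrK => xy.
have := rnormD x (- (x - y)); rewrite rnormN opprB addrC subrK => yx.
by rewrite ler_norml; apply/andP; split; move: xy yx; lra.
Qed.

Lemma rnorm_orthproj_lipschitz S x y :
  `|rnorm (orthproj S x) - rnorm (orthproj S y)| <= rnorm (x - y).
Proof. by rewrite (le_trans (rnormB_le _ _))// -orthprojB rnorm_orthproj. Qed.

Lemma orthproj_setU S K x : S `<=` perp K ->
  orthproj (S `|` K) x = orthproj S x + orthproj K x.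
Proof.
move=> SK; have KS : K `<=` perp S.
  by move=> k Kk s Ss; apply: inner_eq0C; exact: SK.
apply: orthproj_unique.
  apply: perpD.
    by apply: sub_perp (orthproj_perp2 S x); apply: sub_perp => z; left.
  by apply: sub_perp (orthproj_perp2 K x); apply: sub_perp => z; right.
move=> z [Sz|Kz].
  rewrite opprD addrA innerDl (subr_orthproj S x z Sz) innerNl add0r.
  by rewrite (orthproj_perp2 K x _ (SK _ Sz)) oppr0.
rewrite opprD addrCA addrC innerDl (subr_orthproj K x z Kz) innerNl add0r.
by rewrite (orthproj_perp2 S x _ (KS _ Kz)) oppr0.
Qed.

Lemma rnorm_orthproj_setU S K x : S `<=` perp K ->
  rnorm (orthproj (S `|` K) x) ^+ 2 =
  rnorm (orthproj S x) ^+ 2 + rnorm (orthproj K x) ^+ 2.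
Proof.
move=> SK; rewrite orthproj_setU // rnorm_sqrD //.
by apply: (orthproj_perp2 S x); move: (orthproj_perp2 K x); apply: sub_perp.
Qed.

(** Changes the sign on the closed span of [S] and fixes [perp S]. It serves both to negate one
    vector and to swap two families. *)
Definition refl_fun S x := x - 2%:R *: orthproj S x.

Fact refl_linear S : linear (refl_fun S).
Proof.
move=> a x y; rewrite /refl_fun orthproj_linear scalerDr opprD addrACA.
by rewrite scalerBr !scalerA mulrC.
Qed.

Lemma refl_funE S x : refl_fun S x = (x - orthproj S x) - orthproj S x.
Proof. by rewrite /refl_fun scaler_nat mulr2n opprD addrA. Qed.

Fact refl_inner S x y : inner (refl_fun S x) (refl_fun S y) = inner x y.
Proof.
have o a b : inner (orthproj S a) (b - orthproj S b) = 0.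
  by apply: (orthproj_perp2 S a); exact: subr_orthproj.
have o' a b : inner (a - orthproj S a) (orthproj S b) = 0 by apply: inner_eq0C.
rewrite -[in RHS](subrK (orthproj S x) x).
rewrite -[in RHS](subrK (orthproj S y) y) !refl_funE.
move: (o x y) (o' x y).
set x' := x - _; set y' := y - _ => oxy oyx.
clearbody x' y'.
rewrite !(innerDl, innerDr, innerNl, innerNr) oxy oyx opprK !oppr0.
by rewrite !(addr0, add0r).
Qed.

Lemma refl_funK S x : refl_fun S (refl_fun S x) = x.
Proof.
rewrite {1}/refl_fun; have -> : orthproj S (refl_fun S x) = - orthproj S x.
  apply: orthproj_unique; first exact: perpN (orthproj_perp2 _ _).
  by rewrite refl_funE opprK subrK; exact: subr_orthproj.
by rewrite /refl_fun scalerN opprK subrK.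
Qed.

Fact refl_surj S y : exists x, refl_fun S x = y.
Proof. by exists (refl_fun S y); exact: refl_funK. Qed.

Definition refl S : unitary H :=
  Unitary (refl_linear S) (refl_inner S) (refl_surj S).

Lemma reflE S x : S x -> refl S x = - x.
Proof.
move=> Sx; rewrite /= refl_funE (@orthproj_unique _ x x) ?subrr ?sub0r //.
  exact: sub_perp2.
exact: perp0.
Qed.

(* The swapping unitary is the reflection through the orthogonal complement of
   the vectors [p k - q k]. *)
Lemma ex_swap (T : Type) (p q : T -> H) :
  (forall j k, inner (p j) (p k) = inner (q j) (q k)) ->
  (forall j k, inner (p j) (q k) = 0) ->
  exists u : unitary H, forall k, u (p k) = q k.
Proof.
move=> pq pq0; have qp0 j k : inner (q j) (p k) = 0 by apply: inner_eq0C.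
pose S := range (fun k => p k - q k); exists (refl S) => k.
(* The half-sum is orthogonal to every [p j - q j], so the half-difference is the projection of
   [p k], and subtracting it twice leaves [q k]. *)
have pE : p k = 2^-1 *: (p k - q k) + 2^-1 *: (p k + q k).
  rewrite scalerBr scalerDr addrACA addNr addr0 -scalerDl.
  by rewrite [X in X *: _](_ : _ = 1) ?scale1r //; field.
rewrite /= /refl_fun (@orthproj_unique S _ (2^-1 *: (p k - q k))).
- by rewrite scalerA mulfV ?pnatr_eq0 // scale1r opprB addrC subrK.
- by apply: perpZ; apply: sub_perp2; exists k.
rewrite {1}pE addrC addKr; apply: perpZ => _ [j _ <-].
by rewrite !(innerDl, innerDr, innerNr) pq pq0 qp0 oppr0 addr0 add0r subrr.
Qed.

(** [u] maps the closed span of [p] onto that of [q], so it intertwines the two projections. *)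
Lemma rnorm_orthproj_unitary (T : Type) (p q : T -> H) (u : unitary H) x :
  (forall k, u (p k) = q k) ->
  rnorm (orthproj (range q) (u x)) = rnorm (orthproj (range p) x).
Proof.
move=> upq; rewrite -(unitary_rnorm u (orthproj _ x)); congr rnorm.
apply: orthproj_unique.
  move=> y; have [z <-] := unitary_surj u y => qz.
  rewrite unitary_inner; apply: orthproj_perp2 => _ [k _ <-].
  by rewrite -(unitary_inner u) upq; apply: qz; exists k.
move=> _ [k _ <-]; rewrite -unitaryB -upq unitary_inner.
by apply: subr_orthproj; exists k.
Qed.

End ProjectionTheory.
Arguments orthproj_perp2 {R H} S x.
Arguments subr_orthproj {R H} S x.

(** * Orthonormal families and invariant filters *)

Section OrthonormalFamilies.
Context {R : realType} {H : hilbertType R}.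
Implicit Types (x y z : H) (S K : set H).

Definition orthonormal_family (T : Type) (e : T -> H) :=
  (forall t, inner (e t) (e t) = 1) /\
  (forall t t', t <> t' -> inner (e t) (e t') = 0).

(** Zorn's lemma for sets of whole [J]-indexed systems, so that the family comes indexed by [I * J].
    With [J] equal to [nat] it splits into sequences; with [unit] it is an ordinary maximal
    orthonormal family in [K]. *)
Lemma ex_maximal_systems (J : Type) (j0 : J) K :
  exists (I : Type) (e : I * J -> H),
    [/\ orthonormal_family e, range e `<=` K &
        forall s : J -> H, orthonormal_family s -> range s `<=` K ->
          ~ (range s `<=` perp (range e))].
Proof.
pose P (F : set (J -> H)) :=
  (forall s j, F s -> K (s j) /\ inner (s j) (s j) = 1) /\
  (forall s t j k, F s -> F t -> (s, j) <> (t, k) -> inner (s j) (t k) = 0).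
have [F FP totF|A [[AK Aorth] Amax]] := @Zorn_bigcup (J -> H) P.
  split=> [s j [X FX Xs]|s t j k [X FX Xs] [Y FY Yt]].
    by have [+ _] := FP _ FX; apply.
  have [XY|YX] := totF _ _ FX FY.
    by have [_] := FP _ FY; apply => //; exact: XY.
  by have [_] := FP _ FX; apply => //; exact: YX.
pose I := {s : J -> H | A s}; pose e (t : I * J) := sval t.1 t.2.
exists I, e; split.
- split=> [[[s As] j]|[[s As] j] [[t At] k] /= ne].
    by have [] := AK s j As.
  apply: Aorth => // -[st jk]; apply: ne; rewrite jk; congr pair.
  by move: At; rewrite -st => At; congr exist; exact: Prop_irrelevance.
- by move=> _ [[[s As] j] _ <-]; have [] := AK s j As.
move=> s [s1 s0] sK sP.
have se t j k : A t -> inner (s j) (t k) = 0.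
  move=> At; apply: sP; first by exists j.
  by exists (exist _ t At, k).
(* A system already in [A] would be orthogonal to itself; [j0] supplies a unit vector of it. *)
have nAs : ~ A s.
  by move=> /(se _ j0 j0)/eqP; rewrite s1 oner_eq0.
apply: (Amax (A `|` [set s])).
  by split=> [t At|]; [left|move=> /(_ s) sA; apply: nAs; apply: sA; right].
split=> [t j [/AK//|->]|t t' j k [At|->] [At'|->] ne]; first 1 last.
- exact: Aorth.
- by apply: inner_eq0C; exact: se.
- exact: se.
- by apply: s0 => jk; apply: ne; rewrite jk.
by split=> //; apply: sK; exists j.
Qed.

Lemma ex_swap_orthonormal (T U : Type) (e : T -> H) (g h : U -> T) :
  orthonormal_family e -> injective g -> injective h ->
  (forall j k, g j <> h k) ->
  exists u : unitary H, forall k, u (e (g k)) = e (h k).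
Proof.
move=> [e1 e0] ginj hinj gh; apply: ex_swap => j k; last exact/e0/gh.
have [->|jk] := pselect (j = k); first by rewrite !e1.
by rewrite !e0 => // [/hinj|/ginj].
Qed.

Lemma sub_perp_orthonormal (T U V : Type) (e : T -> H)
    (g : U -> T) (h : V -> T) :
  orthonormal_family e -> (forall j k, g j <> h k) ->
  range (e \o g) `<=` perp (range (e \o h)).
Proof. by move=> [_ e0] gh _ [j _ <-] _ [k _ <-]; exact/e0/gh. Qed.

Lemma ex_orthonormal_decomposition :
  exists (I : Type) (e : I * nat -> H) (s : seq H),
    [/\ orthonormal_family e, {in s, forall b, rnorm b = 1} &
        forall x, x = orthproj (range e) x + \sum_(b <- s) inner x b *: b].
Proof.
have [I [e [eo _ emax]]] := @ex_maximal_systems nat 0%N setT.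
have [I' [b [[b1 b0] be bmax]]] := @ex_maximal_systems unit tt (perp (range e)).
(* Infinitely many leftover vectors would contain a further orthonormal sequence orthogonal to [e],
   against [emax]. *)
have fb : finite_set (range b).
  apply: contrapT => /infiniteP/ppcard_leP[f].
  apply: (emax f) => //.
    have fr n : range b (f n) by apply: funS.
    split=> [n|n m nm]; first by have [t _ <-] := fr n.
    have [t _ tn] := fr n; have [t' _ tm] := fr m.
    rewrite -tn -tm; apply: b0 => tt'; apply: nm.
    by apply: (@inj _ _ _ f); rewrite ?in_setT // -[LHS]tn -[RHS]tm tt'.
  by move=> _ [n _ <-]; apply: be; apply: funS.
have [s0 bs] := (finite_seqP _).1 fb.
exists I, e, (undup s0); split=> // [c|x].
  rewrite mem_undup => cs; have : range b c by rewrite bs.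
  move=> [t _ <-]; have := b1 t.
  rewrite inner_rnorm => /(congr1 (@complex.Re R))/= /eqP.
  by rewrite sqrp_eq1 ?rnorm_ge0 // => /eqP.
set y := \sum_(c <- _) _.
have yP c : range b c -> inner y c = inner x c.
  move=> bc.
  have cs : c \in undup s0 by rewrite mem_undup; move: bc; rewrite bs.
  rewrite /y (big_morph (fun z => inner z c) (fun u v => innerDl u v c)
    (linear0l _ _)).
  rewrite (bigD1_seq c) ?undup_uniq //= innerZl big_seq_cond big1 ?addr0.
    by have [t _ <-] := bc; rewrite b1 mulr1.
  move=> c' /andP[]; rewrite mem_undup => c's /eqP ne.
  have : range b c' by rewrite bs.
  move: bc ne => [t _ <-] ne [t' _ c'E]; rewrite innerZl -c'E b0 ?mulr0 //.
  by move=> tt'; apply: ne; rewrite -c'E tt'.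
have ye : perp (range e) y.
  rewrite /y big_seq; apply: (big_ind (perp (range e))) => [|? ?|c].
  - exact: perp0.
  - exact: perpD.
  - by rewrite mem_undup => cs; apply: perpZ; apply: be; rewrite bs.
apply/eqP; rewrite -subr_eq0; apply: contrapT => /negP z0.
pose z := x - (orthproj (range e) x + y).
have ze : perp (range e) z.
  by rewrite /z opprD addrA; apply: perpD (perpN ye); exact: subr_orthproj.
have zb : perp (range b) z.
  move=> c bc; rewrite /z innerDl innerNl innerDl (yP _ bc).
  by rewrite (orthproj_perp2 (range e) x _ (be _ bc)) add0r subrr.
have nz : 0 < rnorm z.
  by rewrite lt_def rnorm_ge0 andbT; apply: contra_neq z0 => /rnorm0_eq0.
(* A nonzero remainder, normalised, would be one more unit vector orthogonal to both families,
   against [bmax]. *)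
pose v := (rnorm z)^-1%:C%C *: z.
apply: (bmax (fun=> v)).
- split=> [_|[] []//]; rewrite inner_rnorm rnormZ ?invr_ge0 ?rnorm_ge0 //.
  by rewrite mulVf ?gt_eqF // expr1n.
- by move=> _ [_ _ <-]; exact: perpZ.
- by move=> _ [_ _ <-]; exact: perpZ.
Qed.

End OrthonormalFamilies.

(** * Filters along which Lipschitz functions become invariant *)

Section InvariantFilter.
Context {R : realType} {H : hilbertType R}.
Implicit Types (x y z : H) (S K : set H).

(* The condition [f 0 = 0] makes [f] bounded on the unit sphere. *)
Definition asymptotically_invariant (F : set_system H) :=
  forall f : H -> R, f 0 = 0 ->
  (forall x y, `|f x - f y| <= rnorm (x - y)) ->
  forall (u : unitary H) (e : R), 0 < e ->
    \forall x \near F, `|f (u x) - f x| < e.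

Context (F : set_system H) {FF : ProperFilter F}
  (Finv : asymptotically_invariant F).

Lemma near_Re_inner y (e : R) : rnorm y = 1 -> 0 < e ->
  \forall x \near F, `|complex.Re (inner x y)| < e.
Proof.
move=> y1 e0.
have := @Finv (fun x => complex.Re (inner x y)) _ _ (refl [set y]) e e0.
rewrite linear0l => /(_ erefl).
have lip x z :
    `|complex.Re (inner x y) - complex.Re (inner z y)| <= rnorm (x - z).
  rewrite (le_trans _ (Re_inner_le _ y1)) // innerDl innerNl.
  by case: (inner x y) (inner z y) => [a b] [c d].
move=> /(_ lip); apply: filterS => x.
(* The reflection flips the sign of the test function, so invariance bounds twice its absolute
   value. *)
have -> : inner (refl [set y] x) y = - inner x y.
  rewrite -(unitary_inner (refl [set y]) x y) (@reflE _ _ [set y] y erefl).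
  by rewrite innerNr opprK.
rewrite raddfN -opprD normrN -mulr2n normrMn.
by have := normr_ge0 (complex.Re (inner x y)); lra.
Qed.

(** The imaginary part is handled by the real-part estimate for ['i%C *: y]. *)
Lemma near_inner y (e : R) : rnorm y = 1 -> 0 < e ->
  \forall x \near F, rnorm (inner x y *: y) < e.
Proof.
move=> y1 e0; have e20 : 0 < e / 2 by rewrite divr_gt0.
have iy1 : rnorm ('i%C *: y) = 1 by rewrite rnorm_iZ.
near=> x.
rewrite (le_lt_trans (rnormZ_le _ y1)) // (splitr e) ltrD //; near: x.
  exact: near_Re_inner.
apply: filterS (near_Re_inner iy1 e20) => x.
rewrite innerZr; case: (inner x y) => a b /=.
by rewrite mul0r mulN1r opprK add0r.
Unshelve. all: by end_near.
Qed.

Lemma near_sum_inner (s : seq H) (e : R) : {in s, forall b, rnorm b = 1} ->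
  0 < e -> \forall x \near F, \sum_(b <- s) rnorm (inner x b *: b) < e.
Proof.
elim: s e => [|b s IH] e s1 e0.
  by apply: nearW => x; rewrite big_nil.
have e20 : 0 < e / 2 by rewrite divr_gt0.
near=> x; rewrite big_cons (splitr e) ltrD //; near: x.
  by apply: near_inner => //; apply: s1; rewrite mem_head.
by apply: IH => // c cs; apply: s1; rewrite inE cs orbT.
Unshelve. all: by end_near.
Qed.

(** The norm of a projection is a 1-Lipschitz test function, and the unitary taking [e (g k)] to
    [e (h k)] turns one of the two norms into the other. *)
Lemma near_rnorm_orthproj (T U : Type) (e : T -> H) (g h : U -> T) (d : R) :
  orthonormal_family e -> injective g -> injective h ->
  (forall j k, g j <> h k) -> 0 < d ->
  \forall x \near F,
    `|rnorm (orthproj (range (e \o g)) x) -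
      rnorm (orthproj (range (e \o h)) x)| < d.
Proof.
move=> eo gi hi gh d0; have [u ugh] := ex_swap_orthonormal eo gi hi gh.
have := @Finv (fun x => rnorm (orthproj (range (e \o h)) x)) _ _ u d d0.
have r0 : rnorm (orthproj (range (e \o h)) 0) = 0.
  apply/eqP; rewrite eq_le rnorm_ge0 (le_trans (rnorm_orthproj _ _)) //.
  by rewrite /rnorm normr0.
move=> /(_ r0 (@rnorm_orthproj_lipschitz _ _ _)); apply: filterS => x.
by rewrite (@rnorm_orthproj_unitary _ _ _ (e \o g) (e \o h) u).
Qed.

Lemma no_asymptotically_invariant_filter :
  ~ (\forall x \near F, rnorm x = 1).
Proof.
move=> F1; have [I [e [s [eo s1 dec]]]] := @ex_orthonormal_decomposition R H.
(* For [k < m], [g m k] enumerates the pairs whose second index is congruent to [k] modulo [m]. *)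
pose g m k (t : I * nat) := (t.1, (m * t.2 + k)%N).
have gi m k : (0 < m)%N -> injective (g m k).
  move=> m0 [i n] [j n'] [-> /eqP]; rewrite eqn_add2r eqn_pmul2l //.
  by move=> /eqP ->.
pose P m k x := rnorm (orthproj (range (e \o g m k)) x).
(* The bounds below give [a <= 6 * d] and [b <= 7 * d], hence [E <= 10 * d = 1 / 2], while
   [1 <= E + S] with [S < d]. *)
pose d : R := 20^-1.
have d0 : 0 < d by rewrite invr_gt0 ltr0n.
have near_eq k : odd k -> (k < 4)%N ->
    \forall x \near F, `|P 2%N 0%N x - P 4%N k x| < d.
  move=> ok k4; apply: near_rnorm_orthproj => //; [exact: gi..|].
  by move=> [i n] [j n'] [_]; lia.
have near_eq01 : \forall x \near F, `|P 2%N 0%N x - P 2%N 1%N x| < d.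
  apply: near_rnorm_orthproj => //; [exact: gi..|].
  by move=> [i n] [j n'] [_]; lia.
have P01 x :
    rnorm (orthproj (range e) x) ^+ 2 = P 2%N 0%N x ^+ 2 + P 2%N 1%N x ^+ 2.
  rewrite -rnorm_orthproj_setU; last first.
    apply: sub_perp_orthonormal => // -[i n] [j n'] [_]; lia.
  congr (rnorm (orthproj _ _) ^+ 2); apply/seteqP; split.
    move=> _ [[i n] _ <-]; have := odd_double_half n.
    case: (odd n) => nE; [right|left]; exists (i, n./2) => //;
      by rewrite /= /g /=; congr (e (_, _)); lia.
  by move=> _ [] [t _ <-]; eexists.
have P13 x : P 2%N 1%N x ^+ 2 = P 4%N 1%N x ^+ 2 + P 4%N 3%N x ^+ 2.
  rewrite -rnorm_orthproj_setU; last first.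
    apply: sub_perp_orthonormal => // -[i n] [j n'] [_]; lia.
  congr (rnorm (orthproj _ _) ^+ 2); apply/seteqP; split.
    move=> _ [[i n] _ <-]; have := odd_double_half n.
    case: (odd n) => nE; [right|left]; exists (i, n./2) => //;
      by rewrite /= /g /=; congr (e (_, _)); lia.
  move=> _ [] [[i n] _ <-].
    exists (i, (2 * n)%N) => //.
    by rewrite /= /g /=; congr (e (_, _)); lia.
  exists (i, (2 * n + 1)%N) => //.
  by rewrite /= /g /=; congr (e (_, _)); lia.
have [x [[x1 [sx x01]] [x41 x43]]] := filter_ex (filterI
  (filterI F1 (filterI (near_sum_inner s1 d0) near_eq01))
  (filterI (near_eq 1%N erefl erefl) (near_eq 3%N erefl erefl))).
have xle : 1 <= rnorm (orthproj (range e) x) +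
    \sum_(b <- s) rnorm (inner x b *: b).
  rewrite -x1 [in leLHS](dec x) (le_trans (rnormD _ _)) // lerD2l.
  elim/big_ind2 : _ => // [|y a z b ya zb]; first by rewrite /rnorm normr0.
  by rewrite (le_trans (rnormD _ _)) // lerD.
have := P01 x; have := P13 x; move: x01 x41 x43 xle sx.
have := rnorm_ge0 (orthproj (range e) x).
have : d = 20^-1 by [].
rewrite !ltr_norml.
have P0 m k : 0 <= P m k x by exact: rnorm_ge0.
have := P0 2%N 0%N; have := P0 2%N 1%N; have := P0 4%N 1%N; have := P0 4%N 3%N.
move: (rnorm (orthproj _ x)) (P 2%N 0%N x) (P 2%N 1%N x) (P 4%N 1%N x)
  (P 4%N 3%N x) (\sum_(b <- s) _).
move=> E a b c1 c3 S; clearbody d.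
move=> c30 c10 b0 a0 dE E0 /andP[ab1 ab2] /andP[ac1 ac2] /andP[ad1 ad2].
move=> E1 Sd bE EE.
(* Otherwise [2 * (a - d) ^+ 2 <= b ^+ 2 <= (a + d) ^+ 2], which fails once [a] exceeds
   [(3 + 2 * sqrt 2) * d], a bound below [6 * d]. *)
have a6 : a <= 6 * d.
  rewrite leNgt; apply/negP => a6.
  have h1 : (a - d) ^+ 2 <= c1 ^+ 2 by rewrite ler_sqr ?nnegrE; lra.
  have h3 : (a - d) ^+ 2 <= c3 ^+ 2 by rewrite ler_sqr ?nnegrE; lra.
  have hb : b ^+ 2 <= (a + d) ^+ 2 by rewrite ler_sqr ?nnegrE; lra.
  nra.
have : E ^+ 2 <= (10 * d) ^+ 2 by nra.
rewrite ler_sqr ?nnegrE //; lra.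
Qed.

End InvariantFilter.

(** * Extension of Lipschitz functions to the compactification *)

Lemma compact_set_type (X : topologicalType) (K : set X) :
  compact K -> compact [set: set_type K].
Proof.
move=> cK F FF _.
have FK : (set_val @ F) K.
  by apply: (@filterE _ F) => x; exact: (set_valP x).
have [p [Kp clp]] := cK (set_val @ F) _ FK.
exists (exist _ p (mem_set Kp)); split=> // B C FB.
move=> [_ [[W oW <-] Wp]] WC.
have FB' : (set_val @ F) (set_val @` B).
  by apply: (@filterS _ F) FB => x Bx; exists x.
have Wp' : W p by move: Wp; rewrite /= set_valE.
have [_ [[x Bx <-] Wx]] := clp _ _ FB' (open_nbhs_nbhs (conj oW Wp')).
by exists x; split=> //; exact: WC.
Qed.

Lemma hausdorff_set_type (X : topologicalType) (K : set X) :
  hausdorff_space X -> hausdorff_space (set_type K).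
Proof.
move=> hX p q clpq; have cts := @initial_continuous (set_type K) X set_val.
have : set_val p = set_val q :> X.
  apply: hX => B C nB nC.
  have [x [Bx Cx]] := clpq _ _ (cts p _ nB) (cts q _ nC).
  by exists (set_val x).
by rewrite set_valE => /val_inj.
Qed.

Lemma continuous_ptws (X T : topologicalType) (I : eqType)
    (f : X -> {ptws I -> T}) :
  (forall i, continuous (fun x => f x i)) -> continuous f.
Proof.
move=> fc x; apply/cvg_sup => i.
have cf : continuous (f : X -> initial_topology (fun h : {ptws I -> T} => h i)).
  by apply: continuous_comp_initial; exact: fc.
exact: cf.
Qed.

Lemma ptws_nbhs (R : realType) (I : eqType) (h : {ptws I -> R}) (i : I)
    (e : R) :
  0 < e -> \forall h' \near h, `|h i - h' i| < e.
Proof.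
move=> e0; have hi : nbhs (h i) [set r | `|h i - r| < e].
  by have := nbhsx_ballx (h i) e e0; rewrite -ball_normE.
exact: (@proj_continuous I (fun=> R) i h _ hi).
Qed.

(** * The compact space of bounded Lipschitz functions on the unitary group *)

Section LipschitzFunctions.
Context {R : realType} (H : hilbertType R).

(* These functions carry the compact [U(H)]-spaces to which the universal
   property is applied; the Lipschitz condition is what makes right translation
   jointly continuous for the uniform topology. *)
Definition lipschitz_set : set {ptws unitary H -> R} :=
  [set h : {ptws unitary H -> R} | forall k, `[-1, 1]%classic (h k)] `&`
  [set h : {ptws unitary H -> R} |
    forall k k', `|h k - h k'| <= unitary_dist k k'].

Definition lipschitz_space : Type := set_type lipschitz_set.

HB.instance Definition _ :=
  Topological.copy lipschitz_space (set_type lipschitz_set).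

(** A closed subset of a Tychonoff cube: each Lipschitz inequality involves two coordinates only, so
    it survives pointwise limits. *)
Lemma lipschitz_set_compact : compact lipschitz_set.
Proof.
apply: compact_closedI.
  apply: (@tychonoff (unitary H) (fun=> R) (fun=> `[-1, 1]%classic)) => _.
  exact: segment_compact.
move=> h clh k k'; apply/ler_addgt0Pl => e e0.
have e20 : 0 < e / 2 by rewrite divr_gt0.
have FN : Filter (nbhs h) by exact: nbhs_filter.
have nb := @filterI _ _ FN _ _ (ptws_nbhs h k e20) (ptws_nbhs h k' e20).
have [h' [lh' [hk hk']]] := clh _ nb.
have -> : e + unitary_dist k k' = e / 2 + (unitary_dist k k' + e / 2).
  by rewrite addrCA -splitr addrC.
rewrite (le_trans (ler_distD (h' k) _ _)) // lerD //; first exact: ltW.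
rewrite (le_trans (ler_distD (h' k') _ _)) // lerD //.
by rewrite distrC ltW.
Qed.

Lemma lipschitz_space_compact_hausdorff : compact_hausdorff lipschitz_space.
Proof.
split; first exact: compact_set_type lipschitz_set_compact.
apply: hausdorff_set_type.
by apply: (@hausdorff_product (unitary H) (fun=> R)) => _; exact: Rhausdorff.
Qed.

Definition lipschitz_val (h : lipschitz_space) : {ptws unitary H -> R} :=
  set_val h.

Lemma lipschitz_valP h : lipschitz_set (lipschitz_val h).
Proof. exact: (set_valP h). Qed.

Lemma lipschitz_val_inj : injective lipschitz_val.
Proof. by move=> x y; rewrite /lipschitz_val set_valE => /val_inj. Qed.

Lemma lipschitz_val_continuous : continuous lipschitz_val.
Proof. exact: (@initial_continuous lipschitz_space _ set_val). Qed.

(** Makes the Lipschitz condition stable under right translation. *)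
Lemma unitary_dist_mulr (k k' g : unitary H) :
  unitary_dist (k * g)%g (k' * g)%g <= unitary_dist k k'.
Proof.
apply: unitary_dist_le => x x1 /=.
by apply: unitary_dist_ub; rewrite unitary_rnorm.
Qed.

(** Gives joint continuity of translation: it bounds the change of [h (k * g)] when [g] varies,
    uniformly in [h] and [k]. *)
Lemma unitary_dist_mull (k g g' : unitary H) :
  unitary_dist (k * g)%g (k * g')%g <= unitary_dist g g'.
Proof.
apply: unitary_dist_le => x x1 /=.
by rewrite -unitaryB unitary_rnorm; exact: unitary_dist_ub.
Qed.

Fact translate_subproof (g : unitary H) (h : lipschitz_space) :
  (fun k => lipschitz_val h (k * g)%g) \in lipschitz_set.
Proof.
have [h1 h2] := lipschitz_valP h; apply/mem_set; split=> [k|k k'].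
  exact: h1.
exact: le_trans (h2 _ _) (unitary_dist_mulr _ _ _).
Qed.

(** Multiplying the argument on the right gives a left action, matching [f (k (g x))] for orbit
    maps. *)
Definition translate (g : unitary H) (h : lipschitz_space) : lipschitz_space :=
  exist _ (fun k => lipschitz_val h (k * g)%g) (translate_subproof g h).

Lemma translateE g h k :
  lipschitz_val (translate g h) k = lipschitz_val h (k * g)%g.
Proof. by rewrite {1}/lipschitz_val set_valE. Qed.

Fact translate1 h : translate 1%g h = h.
Proof.
by apply: lipschitz_val_inj; apply/funext => k; rewrite translateE mulg1.
Qed.

Fact translateM g g' h : translate (g * g')%g h = translate g (translate g' h).
Proof.
by apply: lipschitz_val_inj; apply/funext => k; rewrite !translateE mulgA.
Qed.

Fact translate_continuous :
  continuous (fun p : unitary H * lipschitz_space => translate p.1 p.2).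
Proof.
apply: continuous_comp_initial; apply: continuous_ptws => k [g h].
apply/cvgrPdist_lt => e e0 /=; have e20 : 0 < e / 2 by rewrite divr_gt0.
exists (ball g (e / 2), [set h' | `|lipschitz_val h (k * g)%g -
                                   lipschitz_val h' (k * g)%g| < e / 2]).
  split; first exact: nbhsx_ballx.
  exact: (lipschitz_val_continuous (ptws_nbhs _ (k * g)%g e20)).
move=> [g' h'] /= []; rewrite unitary_ball => gg' hh'.
rewrite -!/(lipschitz_val _) !translateE.
have [_ h'lip] := lipschitz_valP h'.
rewrite (splitr e).
rewrite (le_lt_trans (ler_distD (lipschitz_val h' (k * g)%g) _ _)) //.
rewrite ltrD // (le_lt_trans _ gg') //.
exact: le_trans (h'lip _ _) (unitary_dist_mull _ _ _).
Qed.

HB.instance Definition _ := isGSpace.Build (unitary H) lipschitz_space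
  translate1 translateM translate_continuous.

End LipschitzFunctions.

(** * Orbit maps from the sphere to Lipschitz functions *)

Section OrbitMap.
Context {R : realType} {H : hilbertType R} (f : H -> R) (f0 : f 0 = 0)
  (f_lip : forall x y, `|f x - f y| <= rnorm (x - y)).

Fact orbit_map_subproof (x : sphere H) :
  (fun k : unitary H => f (k (sphere_val x))) \in @lipschitz_set R H.
Proof.
have x1 : rnorm (sphere_val x) = 1 by rewrite /rnorm sphere_norm.
apply/mem_set; split=> [k|k k'] /=.
  (* Comparison with [f 0 = 0] confines the values to [[-1, 1]], since [k] preserves the unit
     norm. *)
  have := f_lip (k (sphere_val x)) 0.
  by rewrite f0 !subr0 unitary_rnorm x1 in_itv /= ler_norml.
by apply: (le_trans (f_lip _ _)); apply: unitary_dist_ub; rewrite x1.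
Qed.

Definition orbit_map (x : sphere H) : lipschitz_space H :=
  exist _ (fun k : unitary H => f (k (sphere_val x))) (orbit_map_subproof x).

Lemma orbit_mapE x k : lipschitz_val (orbit_map x) k = f (k (sphere_val x)).
Proof. by rewrite /lipschitz_val set_valE. Qed.

Lemma orbit_map_morphism : gspace_morphism orbit_map.
Proof.
split=> [|g x]; last first.
  apply: lipschitz_val_inj; apply/funext => k.
  by rewrite translateE !orbit_mapE sphere_actE.
have fk (k : unitary H) : continuous (fun x : sphere H => f (k (sphere_val x))).
  move=> x; apply/(@cvgrPdist_lt _ R _ _ (@nbhs_filter (sphere H) x)) => e e0.
  have xN : \forall y \near x, rnorm (sphere_val x - sphere_val y) < e.
    exact: (@initial_continuous (sphere H) H sphere_val x _ (rnorm_nbhs _ e0)).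
  apply: (@filterS _ _ (@nbhs_filter (sphere H) x) _ _ _ xN) => y xy.
  by rewrite (le_lt_trans (f_lip _ _)) // -unitaryB unitary_rnorm.
apply: continuous_comp_initial; apply: continuous_ptws => k.
suff -> : (fun x => (set_val \o orbit_map) x k) =
  (fun x => f (k (sphere_val x))) by exact: fk.
by apply/funext => x; exact: orbit_mapE.
Qed.

End OrbitMap.

Theorem corollary3p3 (R : realType) (H : hilbertType R)
    (A : gspaceType (unitary H)) (i : sphere H -> A)
    (hA : maximal_compactification i) :
  ~ exists p : A, fixed_point p.
Proof.
move=> [p fixp]; have [_ _ idense iuniv] := hA.
pose F := filter_from (nbhs p) (fun U => sphere_val @` (i @^-1` U)).
have FF : ProperFilter F.
  apply: filter_from_proper.
    apply: filter_from_filter; first by exists setT; exact: filterT.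
    move=> U V pU pV; exists (U `&` V); first exact: filterI.
    by move=> _ [x [Ux Vx] <-]; split; exists x.
  move=> U; rewrite nbhsE => -[W [oW Wp] WU].
  (* Density of the image of [i] keeps every trace nonempty. *)
  have [|y [Wy [x _ xE]]] := idense W _ oW; first by exists p.
  by exists (sphere_val x), x => //; apply: WU; rewrite /= xE.
apply: (@no_asymptotically_invariant_filter R H F FF) => [f f0 f_lip u e e0|].
  have [phi [phic phiG] phiE] := iuniv _ (orbit_map f0 f_lip)
    (lipschitz_space_compact_hausdorff H) (orbit_map_morphism f0 f_lip).
  have e20 : 0 < e / 2 by rewrite divr_gt0.
  (* Equivariance makes [phi p] translation-invariant, so its values at [u] and [1] agree. For [x]
     in a small trace, [f (u x)] and [f x] are the values of [phi (i x)] there, each within [e / 2]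
     of that common value. *)
  have fixu : lipschitz_val (phi p) u = lipschitz_val (phi p) 1%g.
    by rewrite -[in RHS](fixp u) phiG translateE mul1g.
  have nb k : \forall a \near p,
      `|lipschitz_val (phi p) k - lipschitz_val (phi a) k| < e / 2.
    exact: (phic p _ (@lipschitz_val_continuous _ _ (phi p) _
      (ptws_nbhs (lipschitz_val (phi p)) k e20))).
  exists [set a |
    `|lipschitz_val (phi p) u - lipschitz_val (phi a) u| < e / 2 /\
    `|lipschitz_val (phi p) 1%g - lipschitz_val (phi a) 1%g| < e / 2].
    by apply: filterS2 (nb u) (nb 1%g) => a.
  move=> _ [x /= [xu x1] <-]; move: xu x1; rewrite fixu.
  have -> : phi (i x) = orbit_map f0 f_lip x by rewrite phiE.
  rewrite !orbit_mapE /= distrC => xu x1.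
  rewrite (splitr e).
  rewrite (le_lt_trans (ler_distD (lipschitz_val (phi p) 1%g) _ _)) //.
  exact: ltrD.
by exists setT => [|_ [x _ <-]]; [exact: filterT|rewrite /rnorm sphere_norm].
Qed.
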